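(* Let $P$ be a plant and $Q$ a specification. The space complexity of the integrated symbolic control design algorithm described in the context, i.e. the number of transitions in the set $T$ it constructs, is $$O\bigl(\operatorname{card}([X_p]_{2\eta}\cap[X_q]_{2\eta})\bigr).$$
   Context: $\|\cdot\|$ is the infinity norm on $\mathbb R^n$. A control system is $\Sigma=(X,X_0,U,\mathcal U,f)$ with $X\subseteq\mathbb R^n$, $X_0\subseteq X$, $U\subseteq\mathbb R^m$, $\mathcal U$ a subset of the locally essentially bounded functions from intervals $]a,b[$ ($a<0<b$) to $U$, and $f:\mathbb R^n\times U\to\mathbb R^n$ continuous and Lipschitz in $x$ on compact sets uniformly in $u\in U$. A trajectory is a curve $\xi$ with $\dot\xi=f(\xi,u)$ a.e.; $\xi_{xu}(\tau)$ is the point reached at time $\tau$ from $x$ under $u$. Forward complete: every trajectory is defined on an interval $]a,\infty[$. $\Sigma$ is $\delta$-ISS if it is forward complete and $\|\xi_{xu}(t)-\xi_{x'u'}(t)\|\le\beta(\|x-x'\|,t)+\gamma(\|u-u'\|_\infty)$ for all $t\ge0$, $x,x'\in\mathbb R^n$, $u,u'\in\mathcal U$, for some continuous $\gamma$ strictly increasing, unbounded with $\gamma(0)=0$ ($\mathcal K_\infty$) and some continuous $\beta$ with $\beta(\cdot,s)\in\mathcal K_\infty$ and $\beta(r,\cdot)$ decreasing to $0$ ($\mathcal{KL}$). Setting. $P=(X_p,X_{p,0},U_p,\mathcal U_p,f_p)$ is a control system; $Q=(X_q,X_{q,0},U_q,\mathcal U_q,f_q)$ is an autonomous system $\dot x=g_q(x)$,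 viewed as a control system with $U_q=\{0\}$ and only the null input. $X_p$, $U_p$, $X_q$ are bounded. $P$ and $Q$ are $\delta$-ISS with functions $\beta_p,\gamma_p$ and $\beta_q$. Given $\varepsilon>0$, parameters $\theta_p,\theta_q,\tau,\eta,\mu>0$ satisfy $\theta_p+\theta_q\le\varepsilon$, $\beta_p(\theta_p,\tau)+\gamma_p(\mu)+\eta\le\theta_p$, $\beta_q(\theta_q,\tau)+\eta\le\theta_q$. $[A]_\mu=\{a\in A:a_i=k_i\mu,\ k_i\in\mathbb Z\}$; $\mathcal B_{[\eta[}(y)=\prod_i[y_i-\eta,y_i+\eta[$. The symbolic system $S_{\tau,\eta,\mu}(\Sigma)$ has states $[X]_{2\eta}$, inputs $[U]_{2\mu}$ (as constant inputs on $[0,\tau]$), and transitions $x\xrightarrow{u}y$ iff $\xi_{xu}(\tau)\in\mathcal B_{[\eta[}(y)\cap X$ (so there is at most one successor $y$ for each $x,u$). Put $S_p=S_{\tau,\eta,\mu}(P)$, $S_q=S_{\tau,\eta,0}(Q)$, where for $Q$, $\mu=0$ means the input set is $\{0\}$. Algorithm. For a set $T$ of triples, $\mathbf X_{source}(T)=\{x:\exists u,y,\ (x,u,y)\in T\}$. Initialize $X_0:=[X_{p,0}\cap X_{q,0}]_{2\eta}$, $\mathbf X_{target}:=X_0$, $T:=\varnothing$, $Bad:=\varnothing$. While there is $x\in[X_p\cap X_q]_{2\eta}$ with $x\in\mathbf X_{target}\setminus(\mathbf X_{source}(T)\cup Bad)$, take such an $x$ and: compute the successor $y$ of $x$ in $S_q$;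 if $y$ exists and $y\notin Bad$, run through the inputs $u\in[U_p]_{2\mu}$, computing the $u$-successor $z$ of $x$ in $S_p$, stopping as soon as some $u$ gives $z=y$; if such $u$ is found, add $(x,u,y)$ to $T$ and $y$ to $\mathbf X_{target}$. Otherwise (no $y$, or $y\in Bad$, or no such $u$) set $(T,Bad):=\mathbf{NonBlock}(T,x,Bad)$. Function $\mathbf{NonBlock}(T,x,Bad)$: set $Badx:=\{x\}$; while $Badx\ne\varnothing$ take $y\in Badx$; for each $z\in\mathbf X_{source}(T)$, if $(z,u,y)\in T$ for some $u$, remove this triple from $T$ and add $z$ to $Badx$; then remove $y$ from $Badx$ and add $y$ to $Bad$; finally return $(T,Bad)$. The output is the system with states $\mathbf X_{source}(T)$, initial states $X_0\cap\mathbf X_{source}(T)$, inputs $[U_p]_{2\mu}$ and transitions $T$. The $O(\cdot)$ is a worst-case bound with absolute implied constant. *)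

(* Defs.v *)
From HB Require Import structures.
From mathcomp Require Import all_boot all_order all_algebra.
From mathcomp Require Import finmap.
From mathcomp Require Import all_classical all_reals all_analysis.
From mathcomp Require Import ess_sup_inf.

Set Implicit Arguments.
Unset Strict Implicit.
Unset Printing Implicit Defensive.

Import Order.TTheory GRing.Theory Num.Theory.
Import numFieldNormedType.Exports.

Local Open Scope classical_set_scope.
Local Open Scope ring_scope.

(* The norm [`|x|] of the library on ['rV[R]_n] is the infinity norm. *)

Section ComparisonFunctions.
Variable R : realType.

Definition class_Kinfty (g : R -> R) : Prop :=
  [/\ {within `[0, +oo[, continuous g},
      g 0 = 0,
      forall x y : R, 0 <= x -> x < y -> g x < g y &
      forall M : R, exists2 x : R, 0 <= x & M < g x].

(* [b r] is only required to be nonincreasing: [b 0] is identically zero. *)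
Definition class_KL (b : R -> R -> R) : Prop :=
  [/\ {within [set p : R * R | 0 <= p.1 /\ 0 <= p.2],
         continuous (fun p : R * R => b p.1 p.2)},
      forall s : R, 0 <= s -> class_Kinfty (b ^~ s),
      forall r s t : R, 0 <= r -> 0 <= s -> s <= t -> b r t <= b r s &
      forall r : R, 0 <= r -> b r x @[x --> +oo] --> (0 : R)].

End ComparisonFunctions.

Section ControlSystems.
Variable R : realType.

Definition otime (a b : \bar R) : set R :=
  [set t : R | (a < t%:E)%E /\ (t%:E < b)%E].

(* A function on the open time interval ]sig_lo, sig_hi[ with values in R^m;
   the values of [sig_fun] outside this interval are irrelevant. *)
Record signal (m : nat) := Signal {
  sig_lo : \bar R;
  sig_hi : \bar R;
  sig_fun : R -> 'rV[R]_m
}.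

Definition sig_dom (m : nat) (u : signal m) : set R :=
  otime (sig_lo u) (sig_hi u).

Definition locally_ess_bounded (m : nat) (u : signal m) : Prop :=
  forall c d : R, `[c, d] `<=` sig_dom u ->
  exists M : R, {ae lebesgue_measure, forall t : R,
    t \in `[c, d] -> `|sig_fun u t| <= M}.

Definition admissible_signal (m : nat) (U : set 'rV[R]_m) (u : signal m) :
    Prop :=
  [/\ (sig_lo u < 0)%E /\ (0 < sig_hi u)%E,
      forall t : R, sig_dom u t -> U (sig_fun u t),
      forall j : 'I_m,
        measurable_fun (sig_dom u) (fun t : R => sig_fun u t ord0 j) &
      locally_ess_bounded u].

(* The field [cs_f] is only meaningful on R^n x cs_U. *)
Record control_system (n m : nat) := ControlSystem {
  cs_X : set 'rV[R]_n;
  cs_X0 : set 'rV[R]_n;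
  cs_U : set 'rV[R]_m;
  cs_inputs : set (signal m);
  cs_f : 'rV[R]_n -> 'rV[R]_m -> 'rV[R]_n
}.

Definition is_control_system (n m : nat) (S : control_system n m) : Prop :=
  [/\ cs_X0 S `<=` cs_X S,
      cs_inputs S `<=` admissible_signal (cs_U S),
      {within [set p : 'rV[R]_n * 'rV[R]_m | cs_U S p.2],
         continuous (fun p : 'rV[R]_n * 'rV[R]_m => cs_f S p.1 p.2)} &
      forall K : set 'rV[R]_n, compact K ->
        exists L : R, forall (x y : 'rV[R]_n) (u : 'rV[R]_m),
          K x -> K y -> cs_U S u ->
          `|cs_f S x u - cs_f S y u| <= L * `|x - y|].

Definition null_signal (m : nat) : signal m := Signal -oo%E +oo%E (fun=> 0).

Definition autonomous (n : nat) (X X0 : set 'rV[R]_n)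
    (g : 'rV[R]_n -> 'rV[R]_n) : control_system n 1 :=
  ControlSystem X X0 [set 0] [set null_signal 1] (fun x _ => g x).

Definition abs_continuous (n : nat) (c d : R) (xi : R -> 'rV[R]_n) : Prop :=
  forall e : R, 0 < e -> exists2 delta : R, 0 < delta &
  forall (k : nat) (s t : 'I_k -> R),
    (forall i, [/\ c <= s i, s i <= t i & t i <= d]) ->
    (forall i j, i != j -> t i <= s j \/ t j <= s i) ->
    \sum_(i < k) (t i - s i) < delta ->
    \sum_(i < k) `|xi (t i) - xi (s i)| < e.

(* Solutions in the sense of Caratheodory: local absolute continuity makes the
   almost-everywhere equation equivalent to the integral equation. *)
Definition trajectory_under (n m : nat) (S : control_system n m)
    (u : signal m) (a b : \bar R) (xi : R -> 'rV[R]_n) : Prop :=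
  [/\ cs_inputs S u,
      (a < 0)%E /\ (0 < b)%E,
      otime a b `<=` sig_dom u,
      forall c d : R, `[c, d] `<=` otime a b -> abs_continuous c d xi &
      {ae lebesgue_measure, forall t : R, otime a b t ->
         is_derive t 1 xi (cs_f S (xi t) (sig_fun u t))}].

Definition trajectory (n m : nat) (S : control_system n m)
    (a b : \bar R) (xi : R -> 'rV[R]_n) : Prop :=
  exists u : signal m, trajectory_under S u a b xi.

(* [reaches S x u t y] is the graph of the partial function
   (x, u, t) |-> xi_{xu}(t). *)
Definition reaches (n m : nat) (S : control_system n m)
    (x : 'rV[R]_n) (u : signal m) (t : R) (y : 'rV[R]_n) : Prop :=
  exists (a b : \bar R) (xi : R -> 'rV[R]_n),
    [/\ trajectory_under S u a b xi, xi 0 = x, otime a b t & xi t = y].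

Definition forward_complete (n m : nat) (S : control_system n m) : Prop :=
  forall (a b : \bar R) (xi : R -> 'rV[R]_n), trajectory S a b xi ->
  exists xi' : R -> 'rV[R]_n,
    trajectory S a +oo%E xi' /\ {in otime a b, xi' =1 xi}.

Definition sup_dist (m : nat) (u v : signal m) : \bar R :=
  ess_sup lebesgue_measure
    ((fun t : R => `|sig_fun u t - sig_fun v t|%:E)
       \_ (sig_dom u `&` sig_dom v)).

(* Inputs are only locally essentially bounded, so that [sup_dist u u'] may be
   [+oo]; the inequality is then void. *)
Definition delta_ISS (n m : nat) (S : control_system n m)
    (beta : R -> R -> R) (gamma : R -> R) : Prop :=
  [/\ class_KL beta, class_Kinfty gamma, forward_complete S &
      forall (t : R) (x x' : 'rV[R]_n) (u u' : signal m) (y y' : 'rV[R]_n)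
        (d : R),
        0 <= t -> cs_inputs S u -> cs_inputs S u' ->
        reaches S x u t y -> reaches S x' u' t y' ->
        sup_dist u u' = d%:E ->
        `|y - y'| <= beta `|x - x'| t + gamma d].

End ControlSystems.

Section SymbolicSystems.
Variable R : realType.

Definition lattice_points (n : nat) (A : set 'rV[R]_n) (h : R) :
    set 'rV[R]_n :=
  [set a | A a /\ forall i : 'I_n, exists k : int, a ord0 i = k%:~R * h].

Definition half_open_cube (n : nat) (h : R) (y : 'rV[R]_n) : set 'rV[R]_n :=
  [set z | forall i : 'I_n,
     y ord0 i - h <= z ord0 i /\ z ord0 i < y ord0 i + h].

Record symbolic_system (St In : Type) := SymbolicSystem {
  sy_states : set St;
  sy_inputs : set In;
  sy_trans : St -> In -> St -> Prop
}.

Definition symbolic (n m : nat) (tau eta mu : R) (S : control_system R n m) :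
    symbolic_system 'rV[R]_n 'rV[R]_m :=
  let states := lattice_points (cs_X S) (2 * eta) in
  let inputs := lattice_points (cs_U S) (2 * mu) in
  SymbolicSystem states inputs (fun x u y =>
    [/\ states x, inputs u, states y &
        exists (v : signal R m) (p : 'rV[R]_n),
          [/\ {in `[0, tau], forall t, sig_fun v t = u},
              reaches S x v tau p,
              half_open_cube eta y p &
              cs_X S p]]).

End SymbolicSystems.

(* The algorithm, as a nondeterministic small-step transition system: every
   order in which elements may be taken from the various sets is allowed. *)
Section Algorithm.
Variables St In : Type.

Definition source (T : set (St * In * St)) : set St :=
  [set x | exists (u : In) (y : St), T (x, u, y)].

(* [MainLoop]: at the test of the main while loop.
   [BlockLoop Badx]: in NonBlock, at the test of its while loop.
   [BlockScan Badx y Z]: in NonBlock, y has been taken from Badx and Z is what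
   remains to be visited by the for loop over the sources. *)
Inductive control_point :=
  | MainLoop
  | BlockLoop (Badx : set St)
  | BlockScan (Badx : set St) (y : St) (Z : set St).

Record config := Config {
  cfg_T : set (St * In * St);
  cfg_target : set St;
  cfg_Bad : set St;
  cfg_point : control_point
}.

(* [V] is the set of candidate states, [inq] the unique input of [Sq]. *)
Variables (V Init : set St) (Sp : symbolic_system St In).
Variables (InQ : Type) (Sq : symbolic_system St InQ) (inq : InQ).

Definition init_config : config := Config set0 Init set0 MainLoop.

Definition to_process (T : set (St * In * St)) (target Bad : set St) :
    set St :=
  V `&` (target `\` (source T `|` Bad)).

Inductive step : config -> config -> Prop :=
  | step_add T target Bad x u y :
      to_process T target Bad x ->
      sy_trans Sq x inq y -> ~ Bad y ->
      sy_inputs Sp u -> sy_trans Sp x u y ->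
      step (Config T target Bad MainLoop)
           (Config (T `|` [set (x, u, y)]) (target `|` [set y]) Bad MainLoop)
  | step_block T target Bad x :
      to_process T target Bad x ->
      (forall y, sy_trans Sq x inq y ->
         Bad y \/ ~ (exists2 u, sy_inputs Sp u & sy_trans Sp x u y)) ->
      step (Config T target Bad MainLoop)
           (Config T target Bad (BlockLoop [set x]))
  | step_take T target Bad Badx y :
      Badx y ->
      step (Config T target Bad (BlockLoop Badx))
           (Config T target Bad (BlockScan Badx y (source T)))
  | step_remove T target Bad Badx y Z z u :
      Z z -> T (z, u, y) ->
      step (Config T target Bad (BlockScan Badx y Z))
           (Config (T `\` [set (z, u, y)]) target Bad
                   (BlockScan (Badx `|` [set z]) y (Z `\` [set z])))
  | step_skip T target Bad Badx y Z z :
      Z z -> (forall u, ~ T (z, u, y)) ->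
      step (Config T target Bad (BlockScan Badx y Z))
           (Config T target Bad (BlockScan Badx y (Z `\` [set z])))
  | step_done T target Bad Badx y :
      step (Config T target Bad (BlockScan Badx y set0))
           (Config T target (Bad `|` [set y]) (BlockLoop (Badx `\` [set y])))
  | step_return T target Bad :
      step (Config T target Bad (BlockLoop set0))
           (Config T target Bad MainLoop).

Inductive reachable : config -> Prop :=
  | reachable_init : reachable init_config
  | reachable_step c c' : reachable c -> step c c' -> reachable c'.

End Algorithm.

Definition integrated_design_reachable (R : realType) (n m : nat)
    (P : control_system R n m) (Q : control_system R n 1)
    (tau eta mu : R) : config 'rV[R]_n 'rV[R]_m -> Prop :=
  reachable (lattice_points (cs_X P `&` cs_X Q) (2 * eta))
            (lattice_points (cs_X0 P `&` cs_X0 Q) (2 * eta))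
            (symbolic tau eta mu P) (symbolic tau eta 0 Q) 0.

(* Main.v *)
Require Import Defs.
From HB Require Import structures.
From mathcomp Require Import all_boot all_order all_algebra.
From mathcomp Require Import finmap.
From mathcomp Require Import all_classical all_reals all_analysis.
Import Order.TTheory GRing.Theory Num.Theory.
Import numFieldNormedType.Exports.
Local Open Scope classical_set_scope.
Local Open Scope ring_scope.

(** The control that the algorithm builds is deterministic: at every moment,
    including in the middle of a backtracking phase, each state is the source
    of at most one triple of [T].  Indeed a triple [(x, u, y)] is added only
    when [x] is still to be processed, and such an [x] is by definition not yet
    a source of [T]; every other step leaves [T] unchanged or shrinks it.  Such
    an [x] is moreover a grid point of the common state space.  Hence the map
    from triples to sources embeds [T] into the grid of candidate states
    ([reachable_deterministic], [card_fset_set_le_inj]), and the bound holds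
    with constant 1.

    The cardinality of the grid is meaningful because a bounded set contains
    finitely many points of a lattice of positive step
    ([finite_lattice_points]). *)

Lemma row_entry_norm_le (R : realType) (n : nat) (x : 'rV[R]_n) (i : 'I_n) :
  `|x ord0 i| <= `|x|.
Proof.
rewrite [leRHS]/Num.norm /= mx_normrE; apply/bigmax_geP; right => /=.
by exists (ord0, i).
Qed.

(** Boundedness gives a common bound on the integer coordinates of the lattice
    points of [A], so they are all values of one map defined on a finite type of
    integer vectors. *)
Lemma finite_lattice_points (R : realType) (n : nat) (A : set 'rV[R]_n)
    (h : R) :
  0 < h -> bounded_set A -> finite_set (lattice_points A h).
Proof.
move=> h0 [M [_ /(_ (M + 1))]]; rewrite ltrDl ltr01 => /(_ isT) AM.
pose N := Num.bound ((M + 1) / h).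
(* Integers of absolute value below [N] are encoded by sign and magnitude. *)
pose pt (f : {ffun 'I_n -> bool * 'I_N}) : 'rV[R]_n :=
  \row_i ((-1) ^+ (f i).1 * (f i).2%:R * h).
apply: (@sub_finite_set _ _ (range pt)); last exact/finite_image/finite_finset.
move=> x [Ax xh].
have /choice[f fE] i : exists p : bool * 'I_N,
    x ord0 i = (-1) ^+ p.1 * p.2%:R * h.
  have [k xk] := xh i.
  have kN : (`|k| < N)%N.
    rewrite -(ltr_nat R) natr_absz intr_norm.
    apply: le_lt_trans (unstable.ltr_bound _).
    rewrite ler_pdivlMr// -[in leLHS](gtr0_norm h0) -normrM -xk.
    exact: le_trans (row_entry_norm_le _ _ x i) (AM x Ax).
  exists (k < 0, Ordinal kN); rewrite xk {1}[k]intEsign /=.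
  by rewrite rmorphM rmorph_sign.
exists (finfun f) => //; apply/rowP => i.
by rewrite mxE ffunE fE.
Qed.

Lemma card_fset_set_le_inj {T U : choiceType} {A : set T} {B : set U}
    {f : T -> U} :
  {in A &, injective f} -> f @` A `<=` B -> finite_set B ->
  finite_set A /\ (#|` fset_set A| <= #|` fset_set B|)%N.
Proof.
move=> finj fAB finB.
have leAB : (A #<= B)%card.
  by rewrite -(card_le_eql (inj_card_eq finj)); exact: subset_card_le.
split; first exact: card_le_finite leAB finB.
case: finB => k Bk; rewrite (card_fset_set Bk).
by apply: geq_card_fset_set; rewrite -(card_le_eqr Bk).
Qed.

(** The invariant of the run.  Only [step_add] needs an argument: its new source
    [x] belongs to [to_process], which lies in [V] and avoids [source T], so the
    new triple cannot share its source with an older one. *)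
Lemma reachable_deterministic {St In : choiceType} {V Init : set St}
    {Sp : symbolic_system St In} {InQ : Type} {Sq : symbolic_system St InQ}
    {inq : InQ} {c : config St In} :
  reachable V Init Sp Sq inq c ->
  {in cfg_T c &, injective (fun p => p.1.1)} /\
  (fun p => p.1.1) @` cfg_T c `<=` V.
Proof.
elim=> [|{}c c' _ IH cc']; first by split=> [p q|_ [p []]] //; rewrite inE.
case: c c' / cc' IH => //= [T tgt Bad x u y [Vx [_ xNTB]] _ _ _ _|
                            T tgt Bad Badx y Z z u _ _] [Tinj TV].
- have xNT p : T p -> p.1.1 <> x.
    by case: p => [[a b] d] Tp /= ax; apply: xNTB; left; exists b, d; rewrite -ax.
  split=> [p q|_ [p [Tp|->] <-]] //; last by apply: TV; exists p.
  rewrite !inE => -[Tp|->] [Tq|->] //= pq.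
  + by apply: Tinj; rewrite ?inE.
  + by case: (xNT p Tp).
  + by case: (xNT q Tq).
- split=> [p q|_ [p [Tp _] <-]]; last by apply: TV; exists p.
  by rewrite !inE => -[Tp _] [Tq _]; apply: Tinj; rewrite inE.
Qed.

Theorem proposition6p2 :
  exists C : nat,
  forall (R : realType) (n m : nat)
    (P : control_system R n m)
    (Xq Xq0 : set 'rV[R]_n) (gq : 'rV[R]_n -> 'rV[R]_n)
    (betap : R -> R -> R) (gammap : R -> R)
    (betaq : R -> R -> R) (gammaq : R -> R)
    (eps thetap thetaq tau eta mu : R),
  let Q := autonomous Xq Xq0 gq in
  is_control_system P -> is_control_system Q ->
  bounded_set (cs_X P) -> bounded_set (cs_U P) -> bounded_set (cs_X Q) ->
  delta_ISS P betap gammap -> delta_ISS Q betaq gammaq ->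
  0 < eps ->
  0 < thetap -> 0 < thetaq -> 0 < tau -> 0 < eta -> 0 < mu ->
  thetap + thetaq <= eps ->
  betap thetap tau + gammap mu + eta <= thetap ->
  betaq thetaq tau + eta <= thetaq ->
  let G := lattice_points (cs_X P) (2 * eta)
             `&` lattice_points (cs_X Q) (2 * eta) in
  finite_set G /\
  forall c : config 'rV[R]_n 'rV[R]_m,
    integrated_design_reachable P Q tau eta mu c ->
    finite_set (cfg_T c) /\
    (#|` fset_set (cfg_T c)| <= C * #|` fset_set G|)%N.
Proof.
exists 1%N => R n m P Xq Xq0 gq betap gammap betaq gammaq.
move=> eps thetap thetaq tau eta mu Q _ _ bndP _ _ _ _ _ _ _ _ eta0 _ _ _ _ G.
have finG : finite_set G.
  apply/finite_setIl/finite_lattice_points => //.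
  by rewrite mulr_gt0.
split=> // c cr; rewrite mul1n.
have [Tinj TV] := reachable_deterministic cr.
apply: (card_fset_set_le_inj Tinj _ finG).
by apply: subset_trans TV _ => x [[Px Qx] xh].
Qed.
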